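(* Let $\mathcal{H}$ be a Hilbert space that is the direct sum of closed subspaces $\mathcal{M}$ and $\mathcal{N}$. Let $Q=Q_{\mathcal{M}//\mathcal{N}}$ be the bounded projection with range $\mathcal{M}$ and null space $\mathcal{N}$, let $\theta_0(\mathcal{M},\mathcal{N})$ be the minimal angle between $\mathcal{M}$ and $\mathcal{N}$, and put $\alpha_0=\frac{\theta_0(\mathcal{M},\mathcal{N})}{2}$. Then for all $x,y\in\mathcal{H}$ $$\left|\langle Qx,y\rangle-\frac12\langle x,y\rangle\right|\le\frac{\cot(\alpha_0)}{2}\|x\|\|y\|$$ and $$|\langle Qx,y\rangle|\le\frac{\cot(\alpha_0)}{2}\bigl(|\langle x,y\rangle|+\|x\|\|y\|\bigr).$$
   Context: $\mathcal{H}$ is a separable nontrivial complex Hilbert space. The direct sum is algebraic and not assumed orthogonal; a projection is a linear operator $Q$ with $Q^2=Q$ (not necessarily self-adjoint). The minimal (Dixmier) angle between closed subspaces $\mathcal{S},\mathcal{T}$ of $\mathcal{H}$ is the angle $\theta_0(\mathcal{S},\mathcal{T})\in[0,\frac\pi2]$ whose cosine is $c_0(\mathcal{S},\mathcal{T})=\sup\{|\langle x,y\rangle|:x\in\mathcal{S},\,y\in\mathcal{T},\,\|x\|,\|y\|\le1\}$. *)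

(* Defs.v *)
From HB Require Import structures.
From mathcomp Require Import all_boot all_order all_algebra.
From mathcomp Require Import complex.
From mathcomp Require Import all_classical all_reals all_analysis.

Set Implicit Arguments.
Unset Strict Implicit.
Unset Printing Implicit Defensive.

Import Order.TTheory GRing.Theory Num.Theory.
Import numFieldNormedType.Exports.

Local Open Scope classical_set_scope.
Local Open Scope complex_scope.
Local Open Scope ring_scope.

Definition separable (T : topologicalType) : Prop :=
  exists2 D : set T, countable D & dense D.

(* [{dot H for Num.conj}] is linear in its first argument and conjugate-linear
   in its second one. A Hilbert space is a complete normed space over R[i]
   together with an inner product that induces its norm. *)
Definition induces_norm (R : realType) (H : normedModType R[i])
    (ip : {dot H for (@Num.conj R[i])}) : Prop :=
  forall x : H, `|x| ^+ 2 = ip x x.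

Definition closed_subspace (R : realType) (H : normedModType R[i])
    (M : set H) : Prop :=
  submod_closed (mem M) /\ closed M.

Definition algebraic_direct_sum (R : realType) (H : normedModType R[i])
    (M N : set H) : Prop :=
  (forall x : H, exists m n : H, [/\ M m, N n & x = m + n]) /\
  M `&` N = [set 0].

Definition bounded_operator (R : realType) (H : normedModType R[i])
    (Q : {linear H -> H}) : Prop :=
  exists C : R, forall x : H, `|Q x| <= C%:C * `|x|.

Definition bounded_projection_onto_along (R : realType)
    (H : normedModType R[i]) (Q : {linear H -> H}) (M N : set H) : Prop :=
  [/\ bounded_operator Q,
      forall x : H, Q (Q x) = Q x,
      range Q = M
    & Q @^-1` [set 0] = N].

(* In R[i] the modulus `|z| is a complex number with zero imaginary part; [Re]
   turns it into an element of R. *)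
Definition dixmier_cos (R : realType) (H : normedModType R[i])
    (ip : {dot H for (@Num.conj R[i])}) (S T : set H) : R :=
  sup [set complex.Re `|ip x y| | x in S `&` [set x | `|x| <= 1]
                                & y in T `&` [set y | `|y| <= 1]].

Definition minimal_angle (R : realType) (H : normedModType R[i])
    (ip : {dot H for (@Num.conj R[i])}) (S T : set H) : R :=
  acos (dixmier_cos ip S T).

(* At a = 0 this takes the junk value 0; it is not reached for a half of a
   minimal angle, as H = M + N makes the minimal angle of M and N positive. *)
Definition cot (R : realType) (a : R) : R := cos a / sin a.

(* Main.v *)
Require Import Defs.
From HB Require Import structures.
From mathcomp Require Import all_boot all_order all_algebra.
From mathcomp Require Import complex.
From mathcomp Require Import all_classical all_reals all_analysis.
From mathcomp Require Import ring lra.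

Set Implicit Arguments.
Unset Strict Implicit.
Unset Printing Implicit Defensive.

Import Order.TTheory GRing.Theory Num.Theory.
Import numFieldNormedType.Exports.

Local Open Scope classical_set_scope.
Local Open Scope complex_scope.
Local Open Scope ring_scope.

(** The operator 2 Q - 1 is the reflection m + n |-> m - n, for m in M and n in
    N, and <Qx, y> - <x, y> / 2 is half of <(2 Q - 1) x, y>. By Cauchy-Schwarz
    the first inequality reduces to |m - n| <= cot(alpha0) |m + n|. Let c be the
    Dixmier cosine of M and N. As |<m, n>| <= c |m| |n|, a computation
    ([norm_reflection_le]) bounds |m - n|^2 by (1 + c) / (1 - c) |m + n|^2, and
    this factor is cot^2(alpha0) by the double-angle formulas
    ([cot_half_acos]).

    This needs c < 1, which is where the boundedness of Q enters: if |m| <=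
    K |m + n| for all m and n, then the component of m orthogonal to n has norm
    at least |m| / K, whence |<m, n>|^2 <= (1 - 1 / K^2) |m|^2 |n|^2
    ([dixmier_cos_lt1]).

    The second inequality follows from the first by the triangle inequality and
    cot(alpha0) >= 1, since alpha0 is at most pi / 4. *)

(** With a = acos c / 2 the double-angle formulas give 2 cos^2 a = 1 + c and
    2 sin^2 a = 1 - c, so cot^2 a = (1 + c) / (1 - c). The product form is the
    one that [norm_reflection_le] consumes; the bound by 1 uses 0 <= c. *)
Lemma cot_half_acos (R : realType) (c : R) : 0 <= c < 1 ->
  1 <= cot (acos c / 2) /\ cot (acos c / 2) ^+ 2 * (1 - c) = 1 + c.
Proof.
move=> /andP[c0 c1]; set a := acos c / 2.
have acosc : cos (acos c) = c by apply: acosK; rewrite in_itv /=; lra.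
have acos_gt0 : 0 < acos c by apply: acos_gt0; lra.
have acos_le : acos c <= pi by apply: acos_lepi; lra.
have cosa : c = cos a ^+ 2 *+ 2 - 1.
  by rewrite -[in LHS]acosc -cos_mulr2n -mulr_natr divfK// pnatr_eq0.
have sin_gt0 : 0 < sin a by apply: sin_gt0_pi; rewrite /a; lra.
have cos_ge0 : 0 <= cos a by apply: cos_ge0_pihalf; rewrite /a; lra.
have sin2 : sin a ^+ 2 *+ 2 = 1 - c by rewrite sin2cos2; lra.
split.
  rewrite /cot ler_pdivlMr// mul1r.
  rewrite -(@ler_pXn2r _ 2%N)// ?nnegrE//; last exact: ltW.
  lra.
rewrite /cot expr_div_n -sin2 mulrnAr divfK ?sqrf_eq0 ?gt_eqF//.
lra.
Qed.

Lemma norm_real_complex (R : realType) (V : normedZmodType R[i]) (x : V) :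
  (complex.Re `|x|)%:C = `|x|.
Proof. by rewrite RRe_real// normr_real. Qed.

Lemma submod_closed_scale (K : pzRingType) (V : lmodType K) (S : set V) a x :
  submod_closed (mem S) -> S x -> S (a *: x).
Proof.
move=> [S0 S_lin] Sx; apply/set_mem; rewrite -[_ *: _]addr0.
by apply: S_lin; [exact: mem_set|exact: S0].
Qed.

Section InnerProduct.
Variables (R : realType) (H : normedModType R[i]).
Variable ip : {dot H for (@Num.conj R[i])}.
Hypothesis ip_norm : induces_norm ip.

(** The vector on the left is |y|^2 times the component of x orthogonal to y;
    clearing the denominator makes the identity hold for y = 0 too. That its
    right-hand side is nonnegative is the Cauchy-Schwarz inequality; a lower
    bound for it is a strengthened one, see
    [inner_sq_le_of_projection_bound]. *)
Lemma norm_gram_residual (x y : H) :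
  `| `|y| ^+ 2 *: x - ip x y *: y| ^+ 2 =
  `|y| ^+ 2 * (`|x| ^+ 2 * `|y| ^+ 2 - `|ip x y| ^+ 2).
Proof.
rewrite !ip_norm dnormB !dnormZ linearZl_LR linearZr_LR /= !normCK.
rewrite !rmorphM /= !conjCK.
have -> : (ip y y)^* = ip y y by apply: geC0_conj; exact: dnorm_ge0.
ring.
Qed.

Lemma cauchy_schwarz (x y : H) : `|ip x y| <= `|x| * `|y|.
Proof.
have [->|y0] := eqVneq y 0; first by rewrite linear0r !normr0 mulr0.
rewrite -(@ler_pXn2r _ 2%N)// ?nnegrE// ?mulr_ge0// exprMn -subr_ge0.
have y2 : 0 < `|y| ^+ 2 by rewrite exprn_gt0// normr_gt0.
by rewrite -(pmulr_rge0 _ y2) -norm_gram_residual exprn_ge0.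
Qed.

Lemma inner_unit_ball_le1 (x y : H) :
  `|x| <= 1 -> `|y| <= 1 -> complex.Re `|ip x y| <= 1.
Proof.
move=> x1 y1; rewrite -lecR norm_real_complex.
by apply: le_trans (cauchy_schwarz _ _) _; rewrite -[leRHS]mulr1 ler_pM.
Qed.

(** Subspaces are stable under normalization, and the supremum bounds the inner
    products of unit vectors. *)
Lemma inner_le_dixmier_cos (S T : set H) (x y : H) :
  submod_closed (mem S) -> submod_closed (mem T) -> S x -> T y ->
  `|ip x y| <= (dixmier_cos ip S T)%:C * (`|x| * `|y|).
Proof.
move=> S_sub T_sub Sx Ty.
have [->|x0] := eqVneq x 0; first by rewrite linear0l !normr0 mul0r mulr0.
have [->|y0] := eqVneq y 0; first by rewrite linear0r !normr0 !mulr0.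
have normalize (U : set H) z : submod_closed (mem U) -> U z -> z != 0 ->
    (U `&` [set z | `|z| <= 1]) (`|z|^-1 *: z).
  move=> U_sub Uz z0; split; first exact: submod_closed_scale.
  by rewrite /= normrZ normfV normr_id mulVf// normr_eq0.
have sup_unit : complex.Re `|ip (`|x|^-1 *: x) (`|y|^-1 *: y)|
    <= dixmier_cos ip S T.
  apply: ub_le_sup; last first.
    exists (`|x|^-1 *: x); first exact: normalize.
    by exists (`|y|^-1 *: y) => //; exact: normalize.
  by exists 1 => _ [u [_ u1] [v [_ v1] <-]]; exact: inner_unit_ball_le1.
rewrite -ler_pdivrMr ?mulr_gt0 ?normr_gt0//.
move: sup_unit; rewrite -lecR norm_real_complex linearZl_LR linearZr_LR /=.
by rewrite !normrM norm_conjC !normfV !normr_id mulrA -invfM mulrC.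
Qed.

Lemma dixmier_cos_ge0 (S T : set H) :
  submod_closed (mem S) -> submod_closed (mem T) -> 0 <= dixmier_cos ip S T.
Proof.
move=> [/set_mem S0 _] [/set_mem T0 _]; apply: ub_le_sup.
  by exists 1 => _ [u [_ u1] [v [_ v1] <-]]; exact: inner_unit_ball_le1.
exists 0; first by split=> //=; rewrite normr0.
exists 0; first by split=> //=; rewrite normr0.
by rewrite linear0l normr0.
Qed.

(** K bounds the projection of S + T onto S along T. The residual of x against y
    is the sum of |y|^2 x in S and a multiple of y in T, so its norm is at least
    |y|^2 |x| / K: the component of x orthogonal to y cannot be small. By
    [norm_gram_residual] the inner product then stays away from |x| |y|. *)
Lemma inner_sq_le_of_projection_bound (S T : set H) (K : R) (x y : H) :
  submod_closed (mem S) -> submod_closed (mem T) -> 1 <= K ->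
  (forall s t, S s -> T t -> `|s| <= K%:C * `|s + t|) ->
  S x -> T y ->
  `|ip x y| ^+ 2 <= (1 - K^-2)%:C * (`|x| ^+ 2 * `|y| ^+ 2).
Proof.
move=> S_sub T_sub K1 K_bound Sx Ty.
have [->|y0] := eqVneq y 0.
  by rewrite linear0r !normr0 expr0n /= !mulr0.
have y2 : 0 < `|y| ^+ 2 by rewrite exprn_gt0// normr_gt0.
have K2 : 0 < K%:C ^+ 2 by rewrite -rmorphXn ltcR exprn_gt0// (lt_le_trans ltr01).
have Sx' : S (`|y| ^+ 2 *: x) by exact: submod_closed_scale.
have Ty' : T (- (ip x y *: y)).
  by rewrite -scaleNr; exact: submod_closed_scale.
have := K_bound _ _ Sx' Ty'.
rewrite normrZ normrX normr_id.
rewrite -(@ler_pXn2r _ 2%N)// ?nnegrE ?mulr_ge0 ?exprn_ge0//; last first.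
  by rewrite lecR (le_trans ler01).
rewrite !exprMn (norm_gram_residual x y) -mulrA [leRHS]mulrCA ler_pM2l//.
rewrite -ler_pdivrMl// lerBrDr -lerBrDl => /le_trans; apply.
rewrite rmorphB fmorphV rmorphXn rmorph1.
rewrite le_eqVlt; apply/orP; left; apply/eqP; ring.
Qed.

(** [inner_sq_le_of_projection_bound] bounds the inner products over the unit
    balls by sqrt (1 - 1 / K^2), uniformly, so the supremum stays below 1. *)
Lemma dixmier_cos_lt1 (S T : set H) (K : R) :
  submod_closed (mem S) -> submod_closed (mem T) -> 1 <= K ->
  (forall s t, S s -> T t -> `|s| <= K%:C * `|s + t|) ->
  dixmier_cos ip S T < 1.
Proof.
move=> S_sub T_sub K1 K_bound.
have K0 : 0 < K by exact: lt_le_trans K1.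
apply: (@le_lt_trans _ _ (Num.sqrt (1 - K^-2))); last first.
  by rewrite -[ltRHS]sqrtr1 ltr_sqrt// gtrBl invr_gt0 exprn_gt0.
apply: ge_sup.
  have [/set_mem S0 _] := S_sub; have [/set_mem T0 _] := T_sub.
  exists (complex.Re `|ip 0 0|), 0; first by split=> //=; rewrite normr0.
  by exists 0 => //; split=> //=; rewrite normr0.
move=> _ [x [Sx x1] [y [Ty y1] <-]].
rewrite -(@ler_pXn2r _ 2%N)// ?nnegrE ?sqrtr_ge0//; last first.
  by rewrite -lecR norm_real_complex; exact: normr_ge0.
have gap0 : 0 <= 1 - K^-2.
  by rewrite subr_ge0 invf_le1 ?exprn_gt0// expr_ge1// ltW.
rewrite sqr_sqrtr// -lecR.
have -> : (complex.Re `|ip x y| ^+ 2)%:C = `|ip x y| ^+ 2.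
  by rewrite rmorphXn; congr (_ ^+ 2); exact: norm_real_complex.
apply: le_trans (inner_sq_le_of_projection_bound S_sub T_sub K1 K_bound Sx Ty) _.
rewrite -[leRHS]mulr1 ler_wpM2l ?lecR//.
by rewrite -[leRHS]mulr1 ler_pM ?exprn_ge0// expr_le1.
Qed.

(** With a = |x|^2 + |y|^2 and r = Re <x, y>, the claim squared and multiplied by
    1 - c reads (1 - c) (a - 2 r) <= (1 + c) (a + 2 r), that is - 2 r <= c a. It
    holds as |r| <= c |x| |y| and 2 |x| |y| <= a. *)
Lemma norm_reflection_le (c t : R) (x y : H) :
  0 <= c < 1 -> 0 <= t -> t ^+ 2 * (1 - c) = 1 + c ->
  `|ip x y| <= c%:C * (`|x| * `|y|) ->
  `|x - y| <= t%:C * `|x + y|.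
Proof.
move=> /andP[c0 c1] t0 tE ip_le.
rewrite -(@ler_pXn2r _ 2%N)// ?nnegrE ?mulr_ge0 ?lecR//.
rewrite exprMn !ip_norm dnormB dnormD -!ip_norm.
have := normc_ge_Re (ip x y); move: ip_le.
have -> : ip x y + (ip x y)^* = (complex.Re (ip x y) *+ 2)%:C.
  by rewrite rmorphMn /= complexRe ReE -mulr_natr divfK ?pnatr_eq0.
move: (complex.Re (ip x y)) => r.
rewrite -(norm_real_complex x) -(norm_real_complex y).
move: (complex.Re `|x|) (complex.Re `|y|) => u v.
move=> ip_le /le_trans/(_ ip_le).
rewrite -!rmorphM -!rmorphXn -!rmorphD -!rmorphB -rmorphM /= !lecR => r_le.
rewrite -(ler_pM2l (_ : 0 < 1 - c)) ?subr_gt0//.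
rewrite [leRHS]mulrA [(1 - c) * t ^+ 2]mulrC tE.
have uv_le := mulr_ge0 c0 (sqr_ge0 (u - v)).
have := le_trans (ler_norm (- r)); rewrite normrN => /(_ _ r_le) r_ge.
lra.
Qed.
End InnerProduct.

Theorem theorem3p5 (R : realType) (H : completeNormedModType R[i])
    (ip : {dot H for (@Num.conj R[i])})
    (ip_norm : induces_norm ip)
    (H_separable : separable H)
    (H_nontrivial : exists x : H, x != 0)
    (M N : set H)
    (M_closed : closed_subspace M)
    (N_closed : closed_subspace N)
    (MN_sum : algebraic_direct_sum M N)
    (Q : {linear H -> H})
    (Q_proj : bounded_projection_onto_along Q M N) :
  let alpha0 : R := minimal_angle ip M N / 2 in
  forall x y : H,
    `|ip (Q x) y - 2^-1 * ip x y| <= (cot alpha0 / 2)%:C * `|x| * `|y| /\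
    `|ip (Q x) y| <= (cot alpha0 / 2)%:C * (`|ip x y| + `|x| * `|y|).
Proof.
move=> alpha0 x y; have [[C Q_bound] QQ rangeQ kerQ] := Q_proj.
have [M_sub _] := M_closed; have [N_sub _] := N_closed.
have Q_add s t : M s -> N t -> Q (s + t) = s.
  rewrite -rangeQ -kerQ => -[z _ <-] /= Qt0.
  by rewrite linearD /= QQ Qt0 addr0.
have c_bounds : 0 <= dixmier_cos ip M N < 1.
  rewrite dixmier_cos_ge0//=.
  (* 1 + `|C| is at least 1 and C, whatever the sign of C. *)
  apply: (@dixmier_cos_lt1 _ _ _ ip_norm _ _ (1 + `|C|)) => //.
    by rewrite lerDl.
  move=> s t Ms Nt; rewrite -{1}(Q_add s t)//.
  apply: le_trans (Q_bound _) _; rewrite ler_wpM2r// lecR.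
  by rewrite (le_trans (ler_norm C))// lerDr.
have [cot_ge1 cot_sq] := cot_half_acos c_bounds.
rewrite -/(minimal_angle ip M N) -/alpha0 in cot_ge1 cot_sq.
have cot_ge0 : 0 <= cot alpha0 by exact: le_trans cot_ge1.
have Q_half z : `|ip (Q z) y - 2^-1 * ip z y| <=
    (cot alpha0 / 2)%:C * `|z| * `|y|.
  have [m [n [Mm Nn ->]]] := MN_sum.1 z.
  rewrite Q_add//.
  (* Half of the reflection of z = m + n, paired with y. *)
  have -> : ip m y - 2^-1 * ip (m + n) y = 2^-1 * ip (m - n) y.
    by rewrite linearDl linearBl /=; field.
  have -> : (cot alpha0 / 2)%:C = 2^-1 * (cot alpha0)%:C.
    by rewrite rmorphM fmorphV rmorph_nat mulrC.
  rewrite normrM -!mulrA ger0_norm ?invr_ge0// ler_wpM2l ?invr_ge0//.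
  apply: le_trans (cauchy_schwarz ip_norm _ _) _.
  rewrite mulrA ler_wpM2r//.
  apply: (norm_reflection_le ip_norm c_bounds) => //.
  exact: inner_le_dixmier_cos.
split=> //.
rewrite -[ip (Q x) y](subrK (2^-1 * ip x y)).
apply: le_trans (ler_normD _ _) _.
rewrite addrC mulrDr lerD//; last by rewrite mulrA.
rewrite normrM ler_wpM2r// ger0_norm ?invr_ge0//.
have -> : 2^-1 = (2^-1 : R)%:C by rewrite fmorphV rmorph_nat.
by rewrite lecR ler_pdivlMr// mulVf.
Qed.
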